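(* Let $q$ be a prime power and $f(x)\in\mathbb{F}_q[x]$. Then $f$ is a permutation polynomial of $\mathbb{F}_q$ if and only if the following holds: for every positive integer $t$ and all maps $\psi_1,\ldots,\psi_t:\mathbb{F}_q\to\mathbb{F}_q$ such that $F(\psi_1(x),\ldots,\psi_t(x))=x$ for some polynomial $F(x_1,\ldots,x_t)\in\mathbb{F}_q[x_1,\ldots,x_t]$, there exists a polynomial $G(x_1,\ldots,x_t)\in\mathbb{F}_q[x_1,\ldots,x_t]$ satisfying $G(\psi_1(f(x)),\ldots,\psi_t(f(x)))=x$. Moreover, if $f$ is a permutation polynomial of $\mathbb{F}_q$, then for any such $\psi_1,\ldots,\psi_t$ and $G$ one has $$f^{-1}(x)=G(\psi_1(x),\ldots,\psi_t(x)),$$ where $f^{-1}(x)$ denotes the compositional inverse of $f(x)$.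
   Context: $\mathbb{F}_q$ is the finite field with $q$ elements. A polynomial $f\in\mathbb{F}_q[x]$ is a permutation polynomial of $\mathbb{F}_q$ if it induces a bijection $\mathbb{F}_q\to\mathbb{F}_q$. Maps $\mathbb{F}_q\to\mathbb{F}_q$ are identified with elements of $\mathbb{F}_q[x]/(x^q-x)$, and all identities between polynomials are understood modulo $x^q-x$, i.e. as equalities of functions on $\mathbb{F}_q$ (for example ''$F(\psi_1(x),\ldots,\psi_t(x))=x$'' means equality for all $x\in\mathbb{F}_q$). The compositional inverse of a permutation polynomial $f$ is the element $f^{-1}$ of $\mathbb{F}_q[x]/(x^q-x)$ inducing the inverse map. *)

(* Defs.v *)
From HB Require Import structures.
From mathcomp Require Import all_boot all_order all_algebra.
From mathcomp Require Import mpoly.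

Set Implicit Arguments.
Unset Strict Implicit.
Unset Printing Implicit Defensive.

Import GRing.Theory.
Local Open Scope ring_scope.

Definition permutation_poly (F : finFieldType) (f : {poly F}) : Prop :=
  bijective (fun x : F => f.[x]).

(* Elements of F_q[x]/(x^q - x) are identified with maps F -> F, so the
   compositional inverse of f is represented by the map it induces. *)
Definition comp_inverse (F : finFieldType) (f : {poly F})
    (hf : permutation_poly f) : F -> F :=
  invF (bij_inj hf).

Lemma comp_inverseK (F : finFieldType) (f : {poly F})
    (hf : permutation_poly f) :
  cancel (fun x : F => f.[x]) (comp_inverse hf).
Proof. exact: invF_f. Qed.

Lemma comp_inverseVK (F : finFieldType) (f : {poly F})
    (hf : permutation_poly f) :
  cancel (comp_inverse hf) (fun x : F => f.[x]).
Proof. by move=> y; exact: (f_invF (bij_inj hf)). Qed.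

(* Main.v *)
Require Import Defs.
From mathcomp Require Import all_boot all_order all_algebra.
From mathcomp Require Import finfield.
From mathcomp Require Import mpoly.
Import GRing.Theory.
Local Open Scope ring_scope.

(** If [f] permutes [F] and [P] recovers [x] from the values [psi i x], then
    [P] evaluated at the [psi i f.[x]] recovers [f.[x]]; it remains to undo [f]
    by a polynomial, which is possible because every map on a finite field is a
    polynomial function ([poly_interpolation]). So [G] is the univariate
    interpolant of the inverse of [f] with [P] substituted for its variable
    ([meval_horner]).

    Conversely, take [t = 1] and for [psi] the identity, from whose values ['X_0]
    recovers [x]; the resulting [G] induces a left inverse of [f], so [f] is
    injective, hence bijective by finiteness.

    The formula for the inverse is the identity defining [G], read at the
    preimage under [f] of the given point. *)

(** Nonzero elements of a field with [q] elements are [(q - 1)]-th roots of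
    unity, so the power takes only the values [0] and [1]. These indicators are
    the Lagrange basis for interpolation at all the points of [F]. *)
Lemma horner_indicator (F : finFieldType) (a x : F) :
  (1 - ('X - a%:P) ^+ #|F|.-1).[x] = (x == a)%:R.
Proof.
have q1_gt0 : (0 < #|F|.-1)%N by rewrite -subn1 subn_gt0 finNzRing_gt1.
rewrite !hornerE -(subr_eq0 x a); case: (eqVneq (x - a) 0) => [->|xa_neq0].
  by rewrite expr0n eqn0Ngt q1_gt0 subr0.
suff -> : (x - a) ^+ #|F|.-1 = 1 by rewrite subrr.
apply: (mulfI xa_neq0).
by rewrite -exprS (ltn_predK (finNzRing_gt1 F)) expf_card mulr1.
Qed.

Lemma poly_interpolation (F : finFieldType) (h : F -> F) :
  exists g : {poly F}, forall x, g.[x] = h x.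
Proof.
exists (\sum_a h a *: (1 - ('X - a%:P) ^+ #|F|.-1)) => x.
rewrite horner_sum (bigD1 x) //= hornerZ horner_indicator eqxx mulr1.
rewrite big1 ?addr0 // => a a_neq_x.
by rewrite hornerZ horner_indicator eq_sym (negPf a_neq_x) mulr0.
Qed.

(** Composing a univariate polynomial with a multivariate one, by evaluating the
    former at the latter, commutes with evaluation at a point: evaluation is a
    ring morphism fixing constants. *)
Lemma meval_horner (R : comNzRingType) (n : nat) (v : 'I_n -> R)
    (g : {poly R}) (P : {mpoly R[n]}) :
  ((map_poly (mpolyC n (R := R)) g).[P]).@[v] = g.[P.@[v]].
Proof.
rewrite -horner_map -map_poly_comp map_poly_id // => c _ /=.
exact: mevalC.
Qed.

Theorem theorem2p1 (F : finFieldType) (f : {poly F}) :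
  (permutation_poly f <->
     forall (t : nat) (psi : 'I_t -> F -> F), (0 < t)%N ->
       (exists P : {mpoly F[t]},
          forall x : F, P.@[fun i => psi i x] = x) ->
       exists G : {mpoly F[t]},
         forall x : F, G.@[fun i => psi i f.[x]] = x)
  /\
  (forall (hf : permutation_poly f) (t : nat) (psi : 'I_t -> F -> F)
     (G : {mpoly F[t]}), (0 < t)%N ->
     (exists P : {mpoly F[t]},
        forall x : F, P.@[fun i => psi i x] = x) ->
     (forall x : F, G.@[fun i => psi i f.[x]] = x) ->
     forall x : F, comp_inverse hf x = G.@[fun i => psi i x]).
Proof.
split; [split|].
- move=> hf t psi _ [P recP].
  have [g gE] := poly_interpolation F (comp_inverse hf).
  exists (map_poly (mpolyC t (R := F)) g).[P] => x.
  by rewrite meval_horner recP gE comp_inverseK.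
- move=> recover.
  have [||G recG] := recover 1%N (fun _ x => x) => //.
    by exists 'X_ord0 => x; rewrite mevalXU.
  apply: injF_bij => x y fxy.
  by rewrite -[x]recG -[y]recG fxy.
- move=> hf t psi G _ _ recG x.
  by rewrite -[in RHS](comp_inverseVK hf x) recG.
Qed.
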